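(* Let $\{e_i\}_{i=1}^n$ be a basis of $\mathbb{R}^n$. If a mapping $V:\mathrm{Pa}(\{e_i\}_{i=1}^n)\to\mathbb{R}$ is a valuation, then there exist functions $F_{i_1,\dots,i_n}:\mathbb{R}^n\to\mathbb{R}$, with $i_j\in\{1,2\}$ for $j\in\{1,\dots,n\}$, such that \[ V\left(\sum_{i=1}^n[a_i^{(1)},a_i^{(2)}]e_i\right)=\sum_{i_1,\dots,i_n=1}^2F_{i_1,\dots,i_n}(a_1^{(i_1)},\dots,a_n^{(i_n)}) \] for all real $a_i^{(1)}\le a_i^{(2)}$, $i=1,\dots,n$. Conversely, for any collection of functions $F_{i_1,\dots,i_n}:\mathbb{R}^n\to\mathbb{R}$ with $i_j\in\{1,2\}$ for $j\in\{1,\dots,n\}$, the mapping $V:\mathrm{Pa}(\{e_i\}_{i=1}^n)\to\mathbb{R}$ defined by \[ V\left(\sum_{i=1}^n[a_i^{(1)},a_i^{(2)}]e_i\right)=\sum_{i_1,\dots,i_n=1}^2F_{i_1,\dots,i_n}(a_1^{(i_1)},\dots,a_n^{(i_n)}) \] for real $a_i^{(1)}\le a_i^{(2)}$ is a valuation.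
   Context: $\mathrm{Pa}(\{e_i\}_{i=1}^n)=\{\sum_{i=1}^n[a_i,b_i]e_i: a_i\le b_i\}$ is the set of (possibly degenerate, nonempty) compact parallelotopes with edges parallel to the basis vectors, where $\sum_{i=1}^n[a_i,b_i]e_i=\{\sum_i t_ie_i: t_i\in[a_i,b_i]\}$. A map $V:\mathrm{Pa}(\{e_i\}_{i=1}^n)\to\mathbb{R}$ is a valuation if $V(K\cup L)+V(K\cap L)=V(K)+V(L)$ for all $K,L\in\mathrm{Pa}(\{e_i\}_{i=1}^n)$ with $K\cup L\in\mathrm{Pa}(\{e_i\}_{i=1}^n)$. No translation invariance is assumed. *)

(* Defs.v *)
From HB Require Import structures.
From mathcomp Require Import all_boot all_order all_algebra.
From mathcomp Require Import all_classical all_reals.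

Set Implicit Arguments.
Unset Strict Implicit.
Unset Printing Implicit Defensive.

Import Order.TTheory GRing.Theory Num.Theory.

Local Open Scope classical_set_scope.
Local Open Scope ring_scope.

Definition parallelotope (R : realType) (n : nat) (e : n.-tuple 'rV[R]_n)
    (a b : 'I_n -> R) : set 'rV[R]_n :=
  [set \sum_(i < n) t i *: tnth e i |
    t in [set t : 'I_n -> R | forall i, t i \in `[a i, b i]%R]].

Definition Pa (R : realType) (n : nat) (e : n.-tuple 'rV[R]_n) :
    set (set 'rV[R]_n) :=
  [set K | exists a b : 'I_n -> R,
    (forall i, a i <= b i) /\ K = parallelotope e a b].

(* [Pa e] is used as a type (coercion [set_type]), so [V] is defined on
   parallelotopes only; [U] and [I] are the union and the intersection of
   [K] and [L] as elements of that type.  Membership of the intersection in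
   [Pa e] is no extra restriction when [e] is a basis: if the union of the
   nonempty closed sets [K] and [L] is a parallelotope, it is connected, so
   [K] and [L] meet, and a nonempty intersection of two elements of [Pa e]
   is in [Pa e]. *)
Definition is_valuation (R : realType) (n : nat) (e : n.-tuple 'rV[R]_n)
    (V : Pa e -> R) : Prop :=
  forall K L U I : Pa e,
    \val U = \val K `|` \val L -> \val I = \val K `&` \val L ->
    V U + V I = V K + V L.

(* The superscripts and indices 1, 2 are the elements 0, 1 of ['I_2]:
   [a i 0] and [a i 1] are the lower and upper ends of the i-th interval, and
   a multi-index (i_1, ..., i_n) in {1, 2}^n is [s : {ffun 'I_n -> 'I_2}]. *)
Definition is_vertex_sum (R : realType) (n : nat) (e : n.-tuple 'rV[R]_n)
    (F : {ffun 'I_n -> 'I_2} -> 'rV[R]_n -> R) (V : Pa e -> R) : Prop :=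
  forall (a : 'I_n -> 'I_2 -> R) (K : Pa e),
    (forall i, a i 0 <= a i 1) ->
    \val K = parallelotope e (fun i => a i 0) (fun i => a i 1) ->
    V K = \sum_(s : {ffun 'I_n -> 'I_2}) F s (\row_(i < n) a i (s i)).

(* Main.v *)
Require Import Defs.
From HB Require Import structures.
From mathcomp Require Import all_boot all_order all_algebra.
From mathcomp Require Import all_classical all_reals.
From mathcomp Require Import lra.

Set Implicit Arguments.
Unset Strict Implicit.
Unset Printing Implicit Defensive.

Import Order.TTheory GRing.Theory Num.Theory.

Local Open Scope classical_set_scope.
Local Open Scope ring_scope.

(** In coordinates with respect to [e], a parallelotope is a box, given by the
two ends of each of its [n] intervals.

A valuation is a vertex sum because, in one dimension, cutting an interval at
a point gives [V[x,z] + V[y,y] = V[x,y] + V[y,z]] for [x <= y <= z].  Cutting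
[[x,y]] at [0], or, when [0] lies outside, cutting the hull of [0] and [[x,y]]
at the end nearer to [0], gives [V[x,y] = G x + H y], where [G x] and [H y]
are signed sums of values of [V] on intervals with ends among [0] and [x],
respectively [0] and [y] ([lower_upper_part]).
Applied to the [i]-th coordinate of a box, with the other intervals as
parameters, this writes [V] as [V1 + V2], where [V1] ignores the upper and
[V2] the lower [i]-th end.  Both are again valuations in every other
coordinate, so the coordinates can be treated one after another
([vertex_sum_one_ended_off]); at the end each summand depends on a single
vertex.

Conversely, if the union of two boxes is a box, then either one contains the
other or the boxes differ in one coordinate only ([para_union_cases]).  In the
second case, for each choice [s] of ends, the [s]-vertices of the union and of
the intersection are those of the two boxes, in some order, so each summand of
a vertex sum satisfies the valuation identity.  A vertex sum is well defined
on parallelotopes because a parallelotope determines its ends ([para_inj]). *)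

(** * Functions of boxes *)

Section Boxes.
Variables (R : realType) (n : nat).

Definition box := 'I_n -> 'I_2 -> R.

Definition ordered (a : box) := forall i, a i 0 <= a i 1.

Definition ends (x y : R) : 'I_2 -> R := fun k => if k == 0 then x else y.

Lemma ordered_dfwith (a : box) i x y :
  ordered a -> x <= y -> ordered (dfwith a i (ends x y)).
Proof.
move=> oa xy j; have [<-|ij] := eqVneq i j; first by rewrite dfwithin.
by rewrite dfwithout.
Qed.

Lemma dfwith_comm (a : box) i j u v :
  i != j -> dfwith (dfwith a i u) j v = dfwith (dfwith a j v) i u.
Proof.
move=> ij; apply/funext => k.
have [<-|jk] := eqVneq j k; first by rewrite [RHS]dfwithout // !dfwithin.
rewrite [LHS]dfwithout //.
have [<-|ik] := eqVneq i k; first by rewrite !dfwithin.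
by rewrite !dfwithout.
Qed.

Lemma ord2_cases (k : 'I_2) : k = 0 \/ k = 1.
Proof. by case: k => [[|[|//]] p]; [left|right]; apply/val_inj. Qed.

Lemma ends_id (v : 'I_2 -> R) : ends (v 0) (v 1) = v.
Proof. by apply/funext => k; have [->|->] := ord2_cases k. Qed.

Lemma dfwith_id (a : box) i : dfwith a i (ends (a i 0) (a i 1)) = a.
Proof.
apply/funext => j; have [<-|ij] := eqVneq i j; last by rewrite dfwithout.
by rewrite dfwithin ends_id.
Qed.

(** The one-dimensional valuation identity for [[x,y]] and [[y,z]], which meet
in one point, with the other intervals of the box as parameters. *)
Definition valuation_at (f : box -> R) (i : 'I_n) :=
  forall (a : box) x y z, ordered a -> x <= y -> y <= z ->
    f (dfwith a i (ends x z)) + f (dfwith a i (ends y y)) =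
    f (dfwith a i (ends x y)) + f (dfwith a i (ends y z)).

Definition vertex_sum (f : box -> R) :=
  exists F : {ffun 'I_n -> 'I_2} -> 'rV[R]_n -> R, forall a, ordered a ->
    f a = \sum_(s : {ffun 'I_n -> 'I_2}) F s (\row_(i < n) a i (s i)).

(** The state reached when the coordinates outside [r] have been treated: there
[f] sees only the end of the interval that [s] selects. *)
Definition one_ended_off (r : seq 'I_n) (s : 'I_n -> 'I_2) (f : box -> R) :=
  forall a b : box, ordered a -> ordered b ->
    (forall j, j \in r -> a j = b j) ->
    (forall j, j \notin r -> a j (s j) = b j (s j)) -> f a = f b.

(** With the other intervals fixed and [f[x,y]] for the value at [[x,y]], the
lower part is [f[x,0] - f[0,0]] if [x <= 0] and [f[x,x] - f[0,x]] if [x >= 0];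
the maximum gives both cases at once and keeps the intervals ordered.  The
upper part is its mirror image, corrected by the constant [f[0,0]]. *)
Definition lower_part (i : 'I_n) (f : box -> R) (a : box) :=
  let x := a i 0 in
  f (dfwith a i (ends x (Num.max x 0))) - f (dfwith a i (ends 0 (Num.max x 0))).

Definition upper_part (i : 'I_n) (f : box -> R) (a : box) :=
  let y := a i 1 in
  f (dfwith a i (ends (Num.min y 0) y)) - f (dfwith a i (ends (Num.min y 0) 0))
  + f (dfwith a i (ends 0 0)).

(** If [0] lies in the interval, it is cut at [0]; otherwise the interval
between [0] and the far end is cut at the near end. *)
Lemma lower_upper_part i f a : valuation_at f i -> ordered a ->
  f a = lower_part i f a + upper_part i f a.
Proof.
move=> fi oa; rewrite -[in LHS](dfwith_id a i) /lower_part /upper_part.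
move: (oa i); set x := a i 0; set y := a i 1 => xy.
have [x0|x0] := leP x 0; have [y0|y0] := leP y 0.
- have := fi a _ _ _ oa xy y0; lra.
- have := fi a _ _ _ oa x0 (ltW y0); lra.
- have := lt_le_trans x0 xy; lra.
- have := fi a _ _ _ oa (ltW x0) xy; lra.
Qed.

(** The parts at [i] only change the [i]-th interval, in a way that depends on
that interval alone, so they commute with cutting the [j]-th one. *)
Lemma valuation_at_parts i j f : i != j -> valuation_at f j ->
  valuation_at (lower_part i f) j /\ valuation_at (upper_part i f) j.
Proof.
move=> ij fj.
have ji : j != i by rewrite eq_sym.
split=> a x y z oa xy yz; rewrite /lower_part /upper_part;
  rewrite !(dfwithout _ _ ji) !(dfwith_comm _ _ _ ji).
- have o1 := fj _ x y z (ordered_dfwith i oa _) xy yz.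
  set m := Num.max _ _.
  have /o1 h1 : a i 0 <= m by rewrite le_max lexx.
  have /o1 h2 : 0 <= m by rewrite le_max lexx orbT.
  lra.
- have o1 := fj _ x y z (ordered_dfwith i oa _) xy yz.
  set m := Num.min _ _.
  have /o1 h1 : m <= a i 1 by rewrite ge_min lexx.
  have /o1 h2 : m <= 0 by rewrite ge_min lexx orbT.
  have /o1 h3 : 0 <= 0 :> R by [].
  lra.
Qed.

(** Each part no longer sees one of the two [i]-th ends, so [i] may be removed
from the coordinates in which both ends matter. *)
Lemma one_ended_off_parts i r s f : one_ended_off (i :: r) s f ->
  one_ended_off r (dfwith s i 0) (lower_part i f) /\
  one_ended_off r (dfwith s i 1) (upper_part i f).
Proof.
move=> fs.
have main (a b : box) k x y : ordered a -> ordered b ->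
    (forall j, j \in r -> a j = b j) ->
    (forall j, j \notin r -> a j (dfwith s i k j) = b j (dfwith s i k j)) ->
    x <= y -> f (dfwith a i (ends x y)) = f (dfwith b i (ends x y)).
  move=> oa ob abr abs xy; apply: fs; try exact: ordered_dfwith.
    move=> j; have [<-|ij] := eqVneq i j; first by rewrite !dfwithin.
    by rewrite inE eq_sym (negbTE ij) !dfwithout //; apply: abr.
  move=> j; rewrite inE negb_or => /andP[ji jr].
  have ij : i != j by rewrite eq_sym.
  by have := abs j jr; rewrite !dfwithout.
have same (a b : box) k : (forall j, j \in r -> a j = b j) ->
    (forall j, j \notin r -> a j (dfwith s i k j) = b j (dfwith s i k j)) ->
    a i k = b i k.
  move=> abr abs; have [/abr->//|/abs] := boolP (i \in r).
  by rewrite dfwithin.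
split=> a b oa ob abr abs; have ab := same _ _ _ abr abs;
  rewrite /lower_part /upper_part ab.
  by congr (_ - _); apply: (main _ _ _ _ _ oa ob abr abs);
    rewrite le_max lexx ?orbT.
by congr (_ - _ + _); apply: (main _ _ _ _ _ oa ob abr abs);
  rewrite ?ge_min lexx ?orbT.
Qed.

Lemma vertex_sumD f g : vertex_sum f -> vertex_sum g ->
  vertex_sum (fun a => f a + g a).
Proof.
move=> [F fF] [G gG]; exists (fun s x => F s x + G s x) => a oa.
by rewrite fF // gG // big_split.
Qed.

(** Induction on [r]: splitting [f] at the head of [r] gives two functions that
still satisfy the hypotheses on the tail. *)
Lemma vertex_sum_one_ended_off r s f : uniq r ->
  (forall i, i \in r -> valuation_at f i) -> one_ended_off r s f ->
  vertex_sum f.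
Proof.
elim: r s f => [|i r IH] s f /=.
  move=> _ _ fs.
  (* [f] only sees the vertex selected by [s], so its value is that at the
     degenerate box reduced to this vertex. *)
  exists (fun s' x => if s' == finfun s then f (fun i _ => x 0 i) else 0).
  move=> a oa; rewrite -big_mkcond big_pred1_eq; apply: fs => // j _.
  by rewrite mxE ffunE.
move=> /andP[ir ur] fv /one_ended_off_parts[fl fu].
have ri j : j \in r -> i != j by move=> jr; apply: contraNneq ir => ->.
have part j (jr : j \in r) :=
  valuation_at_parts (ri j jr) (fv j (mem_behead (s := i :: r) jr)).
have [F FE] := vertex_sumD (IH _ _ ur (fun j jr => (part j jr).1) fl)
                           (IH _ _ ur (fun j jr => (part j jr).2) fu).
exists F => a oa; rewrite -FE //; apply: lower_upper_part => //.
by apply: fv; rewrite inE eqxx.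
Qed.

Lemma vertex_sum_valuation f : (forall i, valuation_at f i) -> vertex_sum f.
Proof.
move=> fv.
apply: (@vertex_sum_one_ended_off (enum 'I_n) (fun=> 0)) => //.
  exact: enum_uniq.
move=> a b _ _ ab _; congr f; apply/funext => j.
by apply: ab; rewrite mem_enum.
Qed.

End Boxes.

(** * Parallelotopes as boxes *)

Section Parallelotopes.
Variables (R : realType) (n : nat) (e : n.-tuple 'rV[R]_n).
Hypothesis e_basis : basis_of fullv e.

Let para (a : box R n) := parallelotope e (fun i => a i 0) (fun i => a i 1).

Definition point (t : 'I_n -> R) := \sum_(i < n) t i *: tnth e i.

Lemma coord_point t i : coord e i (point t) = t i.
Proof.
rewrite /point; under eq_bigr do rewrite (tnth_nth 0).
by rewrite coord_sum_free // (basis_free e_basis).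
Qed.

Lemma parallelotopeP a v :
  para a v <-> forall i, a i 0 <= coord e i v <= a i 1.
Proof.
split=> [[t tab <-] i|av]; first by rewrite coord_point; have := tab i; rewrite in_itv.
exists (coord e ^~ v) => [i|]; first by rewrite in_itv /=.
rewrite [RHS](coord_basis e_basis) ?memvf //.
by apply: eq_bigr => i _; rewrite (tnth_nth 0).
Qed.

Lemma corner_in a k : ordered a -> para a (point (a ^~ k)).
Proof.
move=> oa; apply/parallelotopeP => i; rewrite coord_point.
by have [->|->] := ord2_cases k; rewrite lexx oa.
Qed.

(** Each corner of one box lies in the other, which compares the ends. *)
Lemma para_inj a b : ordered a -> ordered b -> para a = para b -> a = b.
Proof.
have half c d : ordered c -> para c = para d ->
    forall i, d i 0 <= c i 0 /\ c i 1 <= d i 1.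
  move=> oc cd i.
  have := corner_in 0 oc; rewrite cd => /parallelotopeP/(_ i).
  have := corner_in 1 oc; rewrite cd => /parallelotopeP/(_ i).
  by rewrite !coord_point => /andP[_ ->] /andP[-> _].
move=> oa ob ab; apply/funext => i.
rewrite -[LHS]ends_id -[RHS]ends_id.
have [ba0 ab1] := half _ _ oa ab i; have [ab0 ba1] := half _ _ ob (esym ab) i.
by congr ends; apply: le_anti; rewrite ?ba0 ?ab1 ?ab0 ?ba1.
Qed.

Lemma PaP (K : Pa e) : exists2 a, ordered a & \val K = para a.
Proof.
have [a [b [ab ->]]] := set_mem (valP K).
by exists (fun i => ends (a i) (b i)).
Qed.

(** The maximum makes every pair of ends yield a parallelotope, so that a
function on [Pa e] induces a function on all boxes. *)
Definition para_of (a : box R n) : set 'rV[R]_n :=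
  parallelotope e (fun i => a i 0) (fun i => Num.max (a i 0) (a i 1)).

Lemma para_of_in a : para_of a \in Pa e.
Proof.
apply/mem_set; exists (fun i => a i 0), (fun i => Num.max (a i 0) (a i 1)).
by split=> // i; rewrite le_max lexx.
Qed.

Definition Pa_of a : Pa e := SigSub (para_of_in a).

Lemma val_Pa_of a : ordered a -> \val (Pa_of a) = para a.
Proof.
move=> oa; congr parallelotope; apply/funext => i; exact/max_idPr.
Qed.

(** Cutting one interval of a box at a point displays the box as the union of
two boxes, whose intersection is the slice at that point. *)
Lemma valuation_at_Pa_of V i : is_valuation V -> valuation_at (V \o Pa_of) i.
Proof.
move=> Vval a x y z oa xy yz /=.
have xz := le_trans xy yz.
apply: Vval; rewrite !val_Pa_of; try exact: ordered_dfwith;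
  apply/seteqP; split=> v.
- move=> /parallelotopeP av; have := av i; rewrite dfwithin => /andP[xv vz].
  have [vy|/ltW yv] := leP (coord e i v) y; [left|right];
    apply/parallelotopeP => j; have := av j;
    by have [<-|ij] := eqVneq i j;
      rewrite ?dfwithin ?dfwithout // => _; apply/andP.
- move=> [] /parallelotopeP av; apply/parallelotopeP => j; have := av j;
    have [<-|ij] := eqVneq i j; rewrite ?dfwithin ?dfwithout // /ends /=.
    by move=> /andP[-> vy]; rewrite (le_trans vy).
  by move=> /andP[yv ->]; rewrite (le_trans xy).
- move=> /parallelotopeP av.
  by split; apply/parallelotopeP => j; have := av j;
    have [<-|ij] := eqVneq i j; rewrite ?dfwithin ?dfwithout // /ends /=;
    move=> /andP[yv vy]; rewrite ?(le_trans xy) ?(le_trans vy) ?yv ?vy.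
- move=> [/parallelotopeP av /parallelotopeP bv]; apply/parallelotopeP => j.
  have := av j; have := bv j.
  have [<-|ij] := eqVneq i j; rewrite ?dfwithin ?dfwithout // /ends /=.
  by move=> /andP[-> _] /andP[_ ->].
Qed.

(** * Unions and intersections of parallelotopes *)

Lemma para_setI a b w : ordered w -> para w = para a `&` para b ->
  forall i, w i 0 = Num.max (a i 0) (b i 0) /\ w i 1 = Num.min (a i 1) (b i 1).
Proof.
move=> ow wab.
pose m : box R n := fun i =>
  ends (Num.max (a i 0) (b i 0)) (Num.min (a i 1) (b i 1)).
have wm : para w = para m.
  rewrite wab; apply/seteqP; split=> v.
    move=> [/parallelotopeP av /parallelotopeP bv]; apply/parallelotopeP => i.
    have /andP[a0 a1] := av i; have /andP[b0 b1] := bv i.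
    by rewrite ge_max le_min a0 a1 b0 b1.
  move=> /parallelotopeP mv; split; apply/parallelotopeP => i;
    have := mv i; rewrite ge_max le_min => /andP[/andP[a0 b0] /andP[a1 b1]];
    exact/andP.
have om : ordered m.
  move=> i; have := corner_in 0 ow; rewrite wm => /parallelotopeP/(_ i)/andP[].
  exact: le_trans.
by move=> i; rewrite (para_inj ow om wm).
Qed.

(** A union that is a box contains the corners of both boxes, and each of its
own corners lies in one of them. *)
Lemma para_setU a b u : ordered a -> ordered b -> ordered u ->
  para u = para a `|` para b ->
  forall i, u i 0 = Num.min (a i 0) (b i 0) /\ u i 1 = Num.max (a i 1) (b i 1).
Proof.
move=> oa ob ou uab i.
have ua k : para u (point (a ^~ k)) by rewrite uab; left; exact: corner_in.
have ub k : para u (point (b ^~ k)) by rewrite uab; right; exact: corner_in.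
have inu (c : box R n) k : para u (point (c ^~ k)) -> u i 0 <= c i k <= u i 1.
  by move=> /parallelotopeP/(_ i); rewrite coord_point.
have /andP[a00 a01] := inu a 0 (ua 0); have /andP[a10 a11] := inu a 1 (ua 1).
have /andP[b00 b01] := inu b 0 (ub 0); have /andP[b10 b11] := inu b 1 (ub 1).
have inab k : a i 0 <= u i k <= a i 1 \/ b i 0 <= u i k <= b i 1.
  by have := corner_in k ou; rewrite uab => -[] /parallelotopeP/(_ i);
    rewrite coord_point; [left|right].
split; apply: le_anti; apply/andP; split.
- by rewrite le_min a00.
- by rewrite ge_min; have [/andP[-> _]|/andP[-> _]] := inab 0; rewrite ?orbT.
- by rewrite le_max; have [/andP[_ ->]|/andP[_ ->]] := inab 1; rewrite ?orbT.
- by rewrite ge_max a11.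
Qed.

(** Suppose that neither box contains the other.  If a point [p] of the first
leaves the second in coordinate [i] and a point [q] of the second leaves the
first in coordinate [j], then [i = j]: otherwise replacing the [i]-th
coordinate of [q] by that of [p] gives a point of the union that is in neither
box.  Hence all these coordinates coincide, and in the others each interval
contains the other. *)
Lemma para_union_cases a b u : ordered a -> ordered b ->
  para u = para a `|` para b ->
  [\/ para a `<=` para b, para b `<=` para a |
     exists j, forall i, i != j -> a i = b i].
Proof.
move=> oa ob uab.
have escape c d x : para c x -> ~ para d x ->
    exists i, ~~ (d i 0 <= coord e i x <= d i 1).
  move=> cx dx; apply/existsP; apply: contra_notT dx => /existsPn dx.
  by apply/parallelotopeP => i; apply/negPn.
have mix p q i j : para a p -> para b q ->
    ~~ (b i 0 <= coord e i p <= b i 1) -> ~~ (a j 0 <= coord e j q <= a j 1) ->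
    i = j.
  move=> ap bq bp aq; apply/eqP; apply: contraT => ij.
  pose t := point (fun k => if k == i then coord e k p else coord e k q).
  have : para u t.
    have : para u q by rewrite uab; right.
    have : para u p by rewrite uab; left.
    move=> /parallelotopeP up /parallelotopeP uq; apply/parallelotopeP => k.
    by rewrite coord_point; case: ifP.
  rewrite uab => -[] /parallelotopeP tin.
  - by have := tin j; rewrite coord_point eq_sym (negbTE ij) (negbTE aq).
  - by have := tin i; rewrite coord_point eqxx (negbTE bp).
have [ab|/existsNP[p /not_implyP[ap bp]]] := pselect (para a `<=` para b).
  by constructor 1.
have [ba|/existsNP[q /not_implyP[bq aq]]] := pselect (para b `<=` para a).
  by constructor 2.
have [i bpi] := escape _ _ _ ap bp; have [j aqj] := escape _ _ _ bq aq.
have ij := mix _ _ _ _ ap bq bpi aqj.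
constructor 3; exists i => k ki.
(* Corners of the boxes serve as [p] and [q] here. *)
have ab c : b k 0 <= a k c <= b k 1.
  apply: contraNT ki => bak; apply/eqP; rewrite [RHS]ij.
  by apply: (mix _ _ _ _ (corner_in c oa) bq _ aqj); rewrite coord_point.
have ba c : a k 0 <= b k c <= a k 1.
  apply: contraNT ki => abk; apply/eqP/esym.
  by apply: (mix _ _ _ _ ap (corner_in c ob) bpi); rewrite coord_point.
have /andP[ab0 _] := ab 0; have /andP[_ ab1] := ab 1.
have /andP[ba0 _] := ba 0; have /andP[_ ba1] := ba 1.
rewrite -[LHS]ends_id -[RHS]ends_id.
by congr ends; apply: le_anti; rewrite ?ba0 ?ab1 ?ab0 ?ba1.
Qed.

(** * Valuations and vertex sums *)

Lemma vertex_sum_is_valuation F (V : Pa e -> R) :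
  is_vertex_sum F V -> is_valuation V.
Proof.
move=> FV K L U I UKL IKL.
have [a oa Ka] := PaP K; have [b ob Lb] := PaP L.
have [u ou Uu] := PaP U; have [w ow Iw] := PaP I.
have uab : para u = para a `|` para b by rewrite -Uu UKL Ka Lb.
have wab : para w = para a `&` para b by rewrite -Iw IKL Ka Lb.
have [ab|ba|[j abj]] := para_union_cases oa ob uab.
- have -> : U = L by apply/val_inj; rewrite Uu Lb uab; apply/setUidPr.
  have -> : I = K by apply/val_inj; rewrite Iw Ka wab; apply/setIidPl.
  exact: addrC.
- have -> : U = K by apply/val_inj; rewrite Uu Ka uab; apply/setUidPl.
  by have -> : I = L by apply/val_inj; rewrite Iw Lb wab; apply/setIidPr.
have uE := para_setU oa ob ou uab; have wE := para_setI ow wab.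
rewrite (FV u) // (FV w) // (FV a) // (FV b) // -!big_split.
apply: eq_bigr => s _ /=.
have same i : i != j ->
    u i (s i) = a i (s i) /\ w i (s i) = a i (s i) /\ b i (s i) = a i (s i).
  move=> ij; have [u0 u1] := uE i; have [w0 w1] := wE i.
  rewrite -(abj i ij) !minxx !maxxx in u0 u1 w0 w1.
  rewrite -(abj i ij).
  by have [->|->] := ord2_cases (s i).
have rowE (c d : box R n) : c j (s j) = d j (s j) ->
    (forall i, i != j -> c i (s i) = d i (s i)) ->
    \row_(i < n) c i (s i) = \row_(i < n) d i (s i).
  move=> cdj cd; apply/rowP => i; rewrite !mxE.
  by have [->|/cd] := eqVneq i j.
(* The ends of the union and the intersection are the minimum and maximum of
   those of the two boxes, so they are the same two numbers. *)
have : u j (s j) = a j (s j) /\ w j (s j) = b j (s j) \/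
       u j (s j) = b j (s j) /\ w j (s j) = a j (s j).
  have [u0 u1] := uE j; have [w0 w1] := wE j.
  have [sj|sj] := ord2_cases (s j); rewrite sj ?u0 ?u1 ?w0 ?w1.
    by have [_|_] := leP (a j 0) (b j 0); [left|right].
  by have [_|_] := leP (a j 1) (b j 1); [right|left].
move=> [[uj wj]|[uj wj]]; [|rewrite [RHS]addrC]; congr (F s _ + F s _);
  by apply: rowE => // i /same[ui [wi bi]]; rewrite ?ui ?wi ?bi.
Qed.

Lemma vertex_sum_unique_existence F : exists! V : Pa e -> R, is_vertex_sum F V.
Proof.
pose rep K := projT1 (cid2 (PaP K)).
have rep_ordered K : ordered (rep K) by rewrite /rep; case: cid2.
have repE K : \val K = para (rep K) by rewrite /rep; case: cid2.
exists (fun K => \sum_(s : {ffun 'I_n -> 'I_2}) F s (\row_(i < n) rep K i (s i))).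
split=> [a K oa Ka|V FV].
  by rewrite (para_inj (rep_ordered K) oa) // -repE.
by apply/funext => K; rewrite (FV (rep K) K (rep_ordered K) (repE K)).
Qed.

Lemma valuation_is_vertex_sum (V : Pa e -> R) :
  is_valuation V -> exists F, is_vertex_sum F V.
Proof.
move=> Vval.
have [F FE] := vertex_sum_valuation (fun i => @valuation_at_Pa_of V i Vval).
exists F => a K oa Ka; rewrite -FE //=; congr V; apply/val_inj.
by rewrite val_Pa_of.
Qed.

End Parallelotopes.

Theorem theoremA5 (R : realType) (n : nat) (e : n.-tuple 'rV[R]_n)
    (e_basis : basis_of fullv e) :
  (forall V : Pa e -> R, is_valuation V ->
     exists F : {ffun 'I_n -> 'I_2} -> 'rV[R]_n -> R, is_vertex_sum F V) /\
  (forall F : {ffun 'I_n -> 'I_2} -> 'rV[R]_n -> R,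
     (exists! V : Pa e -> R, is_vertex_sum F V) /\
     (forall V : Pa e -> R, is_vertex_sum F V -> is_valuation V)).
Proof.
split=> [V|F]; first exact: valuation_is_vertex_sum.
split; first exact: vertex_sum_unique_existence.
by move=> V; apply: vertex_sum_is_valuation.
Qed.
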